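(* Let $t\mapsto x(t)\in\mathbf{R}^3$ be an elastica parametrized by arclength, with curvature $\kappa$ and conserved linear momentum $p$. The velocity of the elastica in the direction of $p$ satisfies $$\langle\dot x,p\rangle=-\kappa^2.$$ Hence $$\langle x(t),p\rangle=\langle x(t_0),p\rangle-\int_{t_0}^t\kappa(s)^2\,ds.$$
   Context: An elastica is a curve in $\mathbf{R}^3$ satisfying the Euler-Lagrange equations $\frac{\partial L}{\partial x}-\frac{d}{dt}\frac{\partial L}{\partial\dot x}+\frac{d^2}{dt^2}\frac{\partial L}{\partial\ddot x}=0$ for the Lagrangian $$L(x,\dot x,\ddot x)=\frac{|\ddot x|^2}{|\dot x|^3}-\frac{\langle\dot x,\ddot x\rangle^2}{|\dot x|^5},\qquad \dot x\neq0,$$ i.e. $L\,dt=\kappa^2\,ds$, with $\langle\cdot,\cdot\rangle$ the Euclidean scalar product. The conserved linear momentum is $p=\frac{\partial L}{\partial\dot x}-\frac{d}{dt}\frac{\partial L}{\partial\ddot x}$, which is constant along the elastica because $L$ does not depend on $x$; in the arclength parametrization ($|\dot x|=1$) it equals $p=-2\dddot x-3\langle\ddot x,\ddot x\rangle\dot x$. The curvature is $\kappa=|\ddot x|$. *)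

(* Defs.v *)
From HB Require Import structures.
From mathcomp Require Import all_boot all_order all_algebra.
From mathcomp Require Import all_classical all_reals all_analysis.

Set Implicit Arguments.
Unset Strict Implicit.
Unset Printing Implicit Defensive.

Import Order.TTheory GRing.Theory Num.Theory.
Import numFieldNormedType.Exports.

Local Open Scope ring_scope.
Local Open Scope classical_set_scope.

Definition dotv (R : realType) (n : nat) (u v : 'rV[R]_n) : R :=
  \sum_(i < n) u 0 i * v 0 i.

(* The library norm `|v| on row vectors is the sup norm, hence this one. *)
Definition enorm (R : realType) (n : nat) (v : 'rV[R]_n) : R :=
  Num.sqrt (dotv v v).

Definition gradient (R : realType) (n : nat) (f : 'rV[R]_n.+1 -> R)
    (u : 'rV[R]_n.+1) : 'rV[R]_n.+1 :=
  \row_(i < n.+1) 'D_(delta_mx 0 i) f u.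

(* A second-order Lagrangian L x v a has v and a in the slots of the velocity
   and the acceleration.  The three functions below are its partial gradients
   evaluated along the 2-jet of a curve. *)
Definition grad_pos (R : realType) (n : nat)
    (L : 'rV[R]_n.+1 -> 'rV[R]_n.+1 -> 'rV[R]_n.+1 -> R)
    (x : R -> 'rV[R]_n.+1) (t : R) : 'rV[R]_n.+1 :=
  gradient (fun q => L q (derive1n 1 x t) (derive1n 2 x t)) (x t).

Definition grad_vel (R : realType) (n : nat)
    (L : 'rV[R]_n.+1 -> 'rV[R]_n.+1 -> 'rV[R]_n.+1 -> R)
    (x : R -> 'rV[R]_n.+1) (t : R) : 'rV[R]_n.+1 :=
  gradient (fun v => L (x t) v (derive1n 2 x t)) (derive1n 1 x t).

Definition grad_acc (R : realType) (n : nat)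
    (L : 'rV[R]_n.+1 -> 'rV[R]_n.+1 -> 'rV[R]_n.+1 -> R)
    (x : R -> 'rV[R]_n.+1) (t : R) : 'rV[R]_n.+1 :=
  gradient (fun a => L (x t) (derive1n 1 x t) a) (derive1n 2 x t).

Definition euler_lagrange (R : realType) (n : nat)
    (L : 'rV[R]_n.+1 -> 'rV[R]_n.+1 -> 'rV[R]_n.+1 -> R)
    (x : R -> 'rV[R]_n.+1) (t : R) : Prop :=
  grad_pos L x t - derive1n 1 (grad_vel L x) t
    + derive1n 2 (grad_acc L x) t = 0.

Definition momentum (R : realType) (n : nat)
    (L : 'rV[R]_n.+1 -> 'rV[R]_n.+1 -> 'rV[R]_n.+1 -> R)
    (x : R -> 'rV[R]_n.+1) (t : R) : 'rV[R]_n.+1 :=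
  grad_vel L x t - derive1n 1 (grad_acc L x) t.

Definition elastic_lagrangian (R : realType) (x v a : 'rV[R]_3) : R :=
  enorm a ^+ 2 / enorm v ^+ 3 - dotv v a ^+ 2 / enorm v ^+ 5.

(* Four derivatives are what the Euler-Lagrange equation involves; the library
   derivatives are total functions, so their existence is required here. *)
Definition elastica (R : realType) (I : set R) (x : R -> 'rV[R]_3) : Prop :=
  [/\ forall (k : nat) (t : R), (k < 4)%N -> I t ->
        derivable (derive1n k x) t 1,
      forall t : R, I t -> derive1n 1 x t != 0
    & forall t : R, I t -> euler_lagrange (@elastic_lagrangian R) x t].

Definition arclength_parametrized (R : realType) (I : set R)
    (x : R -> 'rV[R]_3) : Prop :=
  forall t : R, I t -> enorm (derive1n 1 x t) = 1.

(* Curvature of a curve parametrized by arclength. *)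
Definition curvature (R : realType) (x : R -> 'rV[R]_3) (t : R) : R :=
  enorm (derive1n 2 x t).

(* Integral from a to b, with the usual sign when b < a. *)
Definition oriented_integral (R : realType) (a b : R) (f : R -> R) : R :=
  if a <= b then \int[lebesgue_measure]_(s in `[a, b]) f s
  else - \int[lebesgue_measure]_(s in `[b, a]) f s.

(* Main.v *)
Require Import Defs.
From HB Require Import structures.
From mathcomp Require Import all_boot all_order all_algebra.
From mathcomp Require Import all_classical all_reals all_analysis.
From mathcomp Require Import ring.
Set Implicit Arguments.
Unset Strict Implicit.
Unset Printing Implicit Defensive.
Import Order.TTheory GRing.Theory Num.Theory.
Import numFieldNormedType.Exports.
Local Open Scope ring_scope.
Local Open Scope classical_set_scope.

(** Write v, a, j for the first three derivatives of x.  Differentiating L in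
    its slots at a point with |v| = 1 and <v, a> = 0 gives
      dL/dx = 0,   dL/dv = - 3 |a|^2 v,   dL/da = 2 a,
    and along an arclength curve <v, a> = 0 holds because |v|^2 is constant.
    These formulas hold on an open set of parameters, so they can be
    differentiated there: the momentum is p = - 3 |a|^2 v - 2 j.  Since dL/dx
    vanishes, the Euler-Lagrange equation says p' = 0
    ([elastica_momentum_conserved]), hence p is constant on the interval
    ([cst_on_interval]).

    Differentiating <v, a> = 0 once more gives <v, j> = - |a|^2, so
      <v, p> = - 3 |a|^2 + 2 |a|^2 = - |a|^2 = - kappa^2
    ([elastica_velocity_momentum]).  Finally - <x, p> is an antiderivative of
    kappa^2, and the integral formula is the fundamental theorem of calculus
    ([oriented_integral_derivative]).

    The gradients of L are computed from its directional derivatives, through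
    product and chain rules for functions on a normed space
    ([is_derive_dotv], [is_derive_enorm], [gradientE]). *)

(** * The Euclidean scalar product *)

Section dot_product.
Context {R : realType} {n : nat}.
Implicit Types u v w : 'rV[R]_n.

Lemma dotvC u v : dotv u v = dotv v u.
Proof. by apply: eq_bigr => i _; rewrite mulrC. Qed.

Lemma dotvDr u v w : dotv u (v + w) = dotv u v + dotv u w.
Proof. by rewrite -big_split; apply: eq_bigr => i _; rewrite mxE mulrDr. Qed.

Lemma dotvZr u (k : R) v : dotv u (k *: v) = k * dotv u v.
Proof. by rewrite mulr_sumr; apply: eq_bigr => i _; rewrite mxE mulrCA. Qed.

Lemma dotvDl u v w : dotv (u + v) w = dotv u w + dotv v w.
Proof. by rewrite !(dotvC _ w) dotvDr. Qed.

Lemma dotvZl (k : R) u v : dotv (k *: u) v = k * dotv u v.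
Proof. by rewrite !(dotvC _ v) dotvZr. Qed.

Lemma dotvBl u v w : dotv (u - v) w = dotv u w - dotv v w.
Proof. by rewrite -scaleN1r dotvDl dotvZl mulN1r. Qed.

Lemma dotv0r u : dotv u 0 = 0.
Proof. by rewrite -(scale0r 0) dotvZr mul0r. Qed.

Lemma dotv_ge0 u : 0 <= dotv u u.
Proof. by apply: sumr_ge0 => i _; rewrite -expr2 sqr_ge0. Qed.

Lemma dotv_gt0 u : u != 0 -> 0 < dotv u u.
Proof.
move=> u0; rewrite lt_def dotv_ge0 andbT; apply: contra u0 => /eqP duu.
apply/eqP/rowP => i; rewrite mxE; apply/eqP; rewrite -sqrf_eq0 expr2.
by move/eqP: duu; rewrite psumr_eq0 => [/allP/(_ i (mem_index_enum i))|j _]//;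
  rewrite -expr2 sqr_ge0.
Qed.

Lemma dotv_delta u i : dotv u (delta_mx 0 i) = u 0 i.
Proof.
rewrite /dotv (bigD1 i)//= big1 => [|j ji]; rewrite mxE ?eqxx ?mulr1 ?addr0//.
by rewrite (negbTE ji) mulr0.
Qed.

Lemma enorm_sqr u : enorm u ^+ 2 = dotv u u.
Proof. by rewrite sqr_sqrtr// dotv_ge0. Qed.

Lemma enorm_gt0 u : u != 0 -> 0 < enorm u.
Proof. by move=> u0; rewrite sqrtr_gt0 dotv_gt0. Qed.

End dot_product.

(** * Directional derivatives of scalar products and norms *)

Section derivatives.
Context {R : realType} {V : normedModType R}.

Lemma is_derive_coord m n (f : V -> 'M[R]_(m, n)) (q e : V) df i j :
  is_derive q e f df -> is_derive q e (fun y => f y i j) (df i j).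
Proof.
move=> [fq <-]; rewrite derive_mx// mxE; apply: derivableP.
by move/derivable_mxP: fq.
Qed.

Lemma is_derive_dotv n (f g : V -> 'rV[R]_n) (q e : V) df dg :
  is_derive q e f df -> is_derive q e g dg ->
  is_derive q e (fun y => dotv (f y) (g y)) (dotv df (g q) + dotv (f q) dg).
Proof.
move=> f' g'; rewrite /dotv -big_split/=.
have -> : (fun y => \sum_(i < n) f y 0 i * g y 0 i) =
          \sum_(i < n) ((fun y => f y 0 i) * (fun y => g y 0 i)).
  by apply/funext => y; rewrite fct_sumE.
apply: is_derive_sum => i.
have fi' := is_derive_coord 0 i f'; have gi' := is_derive_coord 0 i g'.
apply: is_derive_eq.
by rewrite [df 0 i * _]mulrC addrC.
Qed.

(** The one-variable chain rule suffices: a directional derivative is the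
    derivative at 0 of the restriction to a line. *)
Lemma is_derive_real_comp (f : R -> R) (g : V -> R) (q e : V) a b :
  is_derive (g q) 1 f a -> is_derive q e g b -> is_derive q e (f \o g) (a * b).
Proof.
have lineE (h : V -> R) : 'D_e h q = 'D_1 (fun r : R => h (r *: e + q)) 0.
  rewrite /derive; set g1 := fun h => h^-1 *: _; set g2 := fun h => h^-1 *: _.
  suff -> : g1 = g2 by [].
  apply/funext => r; rewrite /g1 /g2 /=.
  by rewrite addr0 scale0r add0r [_%:A]mulr1.
move=> f' [gq gE].
have g' : is_derive (0 : R) 1 (fun r : R => g (r *: e + q)) b.
  by apply: DeriveDef; [exact: (derivable1P g q e).1|rewrite -lineE].
have [fgq fgE] :
    is_derive (0 : R) 1 (f \o (fun r : R => g (r *: e + q))) (a * b).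
  by apply: is_derive1_comp; rewrite scale0r add0r.
by apply: DeriveDef; [exact: (derivable1P (f \o g) q e).2|rewrite lineE].
Qed.

Lemma is_derive_inv (f : V -> R) (q e : V) df : f q != 0 ->
  is_derive q e f df -> is_derive q e (fun y => (f y)^-1) (- f q ^- 2 *: df).
Proof.
by move=> fq0 [f' <-]; apply: DeriveDef; [exact: derivableV|exact: deriveV].
Qed.

Lemma is_derive_enorm n (f : V -> 'rV[R]_n) (q e : V) df :
  f q != 0 -> is_derive q e f df ->
  is_derive q e (fun y => enorm (f y)) (dotv (f q) df / enorm (f q)).
Proof.
move=> fq0 f'; have sqrt' := is_derive1_sqrt (dotv_gt0 fq0).
apply: is_derive_eq.
  exact: (is_derive_real_comp (g := fun y => dotv (f y) (f y)) sqrt'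
            (is_derive_dotv f' f')).
have := enorm_gt0 fq0; rewrite /enorm => N0.
by rewrite (dotvC df); field; rewrite gt_eqF.
Qed.

End derivatives.

(** * Gradients of the elastic Lagrangian *)

Section gradients.
Context {R : realType}.

Lemma gradientE n (f : 'rV[R]_n.+1 -> R) u g :
  (forall e, is_derive u e f (dotv g e)) -> gradient f u = g.
Proof.
move=> f'; apply/rowP => i; rewrite mxE -(dotv_delta g).
by have [_] := f' (delta_mx 0 i).
Qed.

Lemma gradient_cst n (k : R) (u : 'rV[R]_n.+1) : gradient (fun=> k) u = 0.
Proof.
apply: gradientE => e; rewrite dotvC dotv0r.
exact: is_derive_cst.
Qed.

Lemma elastic_gradient_acc (q v a : 'rV[R]_3) :
  gradient (fun a => elastic_lagrangian q v a) a =
  (2 / enorm v ^+ 3) *: a - (2 * dotv v a / enorm v ^+ 5) *: v.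
Proof.
apply: gradientE => e.
have aa' := is_derive_dotv (is_derive_id a e) (is_derive_id a e).
have va' := is_derive_dotv (is_derive_cst v a e) (is_derive_id a e).
have -> : (fun a => elastic_lagrangian q v a) =
   (enorm v ^+ 3)^-1 *: (fun a => dotv a a) -
   (enorm v ^+ 5)^-1 *: (fun a => dotv v a) ^+ 2.
  apply/funext => b; rewrite /elastic_lagrangian enorm_sqr.
  by rewrite /GRing.scale/= !fctE mulrC [X in _ - X]mulrC.
apply: is_derive_eq.
rewrite dotvBl !dotvZl [dotv 0 a]dotvC dotv0r (dotvC e) /GRing.scale/=.
ring.
Qed.

Lemma elastic_gradient_vel (q v a : 'rV[R]_3) : v != 0 ->
  gradient (fun v => elastic_lagrangian q v a) v =
  (5 * dotv v a ^+ 2 / enorm v ^+ 7 - 3 * dotv a a / enorm v ^+ 5) *: v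
  - (2 * dotv v a / enorm v ^+ 5) *: a.
Proof.
move=> v0; apply: gradientE => e.
have N0 := enorm_gt0 v0.
have N' := is_derive_enorm v0 (is_derive_id v e).
have va' := is_derive_dotv (is_derive_id v e) (is_derive_cst a v e).
have NV k : is_derive v e (fun y => (enorm y ^+ k)^-1)
    (- (enorm v ^+ k) ^- 2 *:
       ((k%:R * enorm v ^+ k.-1) *: (dotv v e / enorm v))).
  apply: is_derive_inv; first by rewrite expf_neq0// gt_eqF.
  by have := is_deriveX k N'; rewrite exprfctE.
have -> : (fun v => elastic_lagrangian q v a) =
   dotv a a *: (fun v : 'rV_3 => (enorm v ^+ 3)^-1) -
   (fun v => dotv v a) ^+ 2 * (fun v : 'rV_3 => (enorm v ^+ 5)^-1).
  by apply/funext => b; rewrite /elastic_lagrangian enorm_sqr.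
apply: is_derive_eq.
rewrite dotvBl !dotvZl dotv0r (dotvC e) exprfctE /GRing.scale/=.
by field; rewrite gt_eqF.
Qed.

End gradients.

(** * Calculus on an interval *)

Section calculus_on_intervals.
Context {R : realType}.

(** The mean value theorem has no vector-valued form, so it is applied to each
    coordinate. *)
Lemma cst_on_interval n (I : set R) (f : R -> 'rV[R]_n) : is_interval I ->
  (forall t, I t -> is_derive t 1 f 0) ->
  forall s t, I s -> I t -> f s = f t.
Proof.
move=> intI f' s t; wlog st : s t / s <= t.
  by move=> H; have [/H//|/ltW/H H' *] := leP s t; apply/esym/H'.
move=> Is It; apply/rowP => i.
have Ist r : r \in `[s, t]%R -> I r.
  by rewrite in_itv/= => str; exact: (intI s t).
have fi' r : I r -> is_derive r 1 (fun y => f y 0 i) 0.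
  by move=> /f'/(is_derive_coord 0 i); rewrite mxE.
have [||c _ /eqP] := @MVT_segment _ (fun y => f y 0 i) (cst 0) s t st.
- by move=> r rst; apply/fi'/Ist; exact: subset_itv_oo_cc rst.
- by apply: derivable_within_continuous => r /Ist/fi'[].
- by rewrite mul0r subr_eq0 => /eqP.
Qed.

(** Differentiability of f is a convenient way to guarantee that it is
    continuous, as the fundamental theorem of calculus demands. *)
Lemma oriented_integral_derivative (I : set R) (F f : R -> R) : is_interval I ->
  (forall t, I t -> is_derive t 1 F (f t)) ->
  (forall t, I t -> derivable f t 1) ->
  forall a b, I a -> I b -> oriented_integral a b f = F b - F a.
Proof.
move=> intI F' f' a b Ia Ib.
have FTC c d : I c -> I d -> c < d ->
    \int[lebesgue_measure]_(s in `[c, d]) f s = F d - F c.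
  move=> Ic Id cd.
  have Icd r : r \in `[c, d]%R -> I r.
    by rewrite in_itv/= => crd; exact: (intI c d).
  have contF r : I r -> {for r, continuous F}.
    by move=> /F'[+ _] => /derivable1_diffP/differentiable_continuous.
  rewrite /Rintegral (@continuous_FTC2 _ f F)//.
  - by apply: derivable_within_continuous => r /Icd/f'.
  - split.
    + by move=> r /subset_itv_oo_cc/Icd/F'[].
    + exact/cvg_at_right_filter/contF.
    + exact/cvg_at_left_filter/contF.
  - by move=> r /subset_itv_oo_cc/Icd/F'[_ <-]; rewrite derive1E.
rewrite /oriented_integral; have [|ba] := leP a b; last by rewrite FTC// opprB.
rewrite le_eqVlt => /predU1P[<-|]; last exact: FTC.
by rewrite set_itv1 /Rintegral integral_set1 subrr.
Qed.

End calculus_on_intervals.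

(** * Curves and their momentum *)

Section curves.
Context {R : realType}.

Lemma near_open (I : set R) (P : R -> Prop) t :
  open I -> I t -> (forall s, I s -> P s) -> \near t, P t.
Proof. by move=> openI It IP; apply: filterS IP _; apply: open_nbhs_nbhs. Qed.

Lemma is_derive_derive1n (V : normedModType R) (x : R -> V) k t :
  derivable (derive1n k x) t 1 ->
  is_derive t 1 (derive1n k x) (derive1n k.+1 x t).
Proof. by rewrite derive1nS derive1E; exact: derivableP. Qed.

Lemma derivable_scale m n (k : R -> R) (f : R -> 'M[R]_(m, n)) t :
  derivable k t 1 -> derivable f t 1 -> derivable (fun s => k s *: f s) t 1.
Proof.
move=> k' /derivable_mxP f'; apply/derivable_mxP => i j.
have -> : (fun s => (k s *: f s) i j) = k * (fun s => f s i j).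
  by apply/funext => s; rewrite mxE.
exact: derivableM k' (f' i j).
Qed.

(** Noether's theorem for translations: when the position gradient vanishes, the
    Euler-Lagrange equation is the statement that the momentum has derivative
    zero.  The differentiability hypotheses are what makes the derivative of
    the difference split. *)
Lemma momentum_derive n
    (L : 'rV[R]_n.+1 -> 'rV[R]_n.+1 -> 'rV[R]_n.+1 -> R) x t :
  grad_pos L x t = 0 -> derivable (grad_vel L x) t 1 ->
  derivable (derive1n 1 (grad_acc L x)) t 1 ->
  euler_lagrange L x t -> is_derive t 1 (momentum L x) 0.
Proof.
rewrite /euler_lagrange => -> v' a'; rewrite sub0r => EL.
have v'' := @is_derive_derive1n _ _ 0 t v'.
apply: (is_derive_eq (is_deriveB v'' (is_derive_derive1n a'))).
by apply/eqP; rewrite -oppr_eq0 opprB addrC; exact/eqP.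
Qed.

(** The derivative of |v|^2 is 2 <v, a>. *)
Lemma velocity_orthogonal_acceleration n (I : set R) (x : R -> 'rV[R]_n)
    (c : R) t :
  open I -> (forall s, I s -> derivable (derive1n 1 x) s 1) ->
  (forall s, I s -> dotv (derive1n 1 x s) (derive1n 1 x s) = c) -> I t ->
  dotv (derive1n 1 x t) (derive1n 2 x t) = 0.
Proof.
move=> openI x'' xc It.
have vv' := is_derive_dotv (is_derive_derive1n (x'' t It))
                           (is_derive_derive1n (x'' t It)).
have : is_derive t 1 (fun s => dotv (derive1n 1 x s) (derive1n 1 x s)) 0.
  apply: near_eq_is_derive (is_derive_cst c t 1).
  by apply: near_open openI It _ => s /xc ->.
move=> /@derive_val; rewrite derive_val dotvC -mulr2n => /eqP.
by rewrite mulrn_eq0 => /eqP.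
Qed.

End curves.

(** * Elasticae parametrized by arclength *)

Section elastica.
Context {R : realType}.
Variables (I : set R) (x : R -> 'rV[R]_3).
Hypotheses (openI : open I) (elx : elastica I x)
  (arcx : arclength_parametrized I x).

Let v := derive1n 1 x.
Let a := derive1n 2 x.
Let j := derive1n 3 x.

Let x' k t : (k < 4)%N -> I t ->
  is_derive t 1 (derive1n k x) (derive1n k.+1 x t).
Proof. by case: elx => x' _ _ *; apply/is_derive_derive1n/x'. Qed.

Lemma elastica_velocity_acceleration t : I t -> dotv (v t) (a t) = 0.
Proof.
apply: (@velocity_orthogonal_acceleration _ _ I x 1) => // s Is.
  by have [] := @x' 1%N s isT Is.
by rewrite -enorm_sqr arcx// expr1n.
Qed.

(** This is the derivative of <v, a> = 0. *)
Lemma elastica_velocity_jerk t : I t -> dotv (v t) (j t) = - dotv (a t) (a t).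
Proof.
move=> It.
have va' := is_derive_dotv (@x' 1%N t isT It) (@x' 2%N t isT It).
have : is_derive t 1 (fun s => dotv (v s) (a s)) 0.
  apply: near_eq_is_derive (is_derive_cst 0 t 1).
  by apply: near_open openI It _ => s /elastica_velocity_acceleration ->.
by move=> /@derive_val; rewrite derive_val addrC => /eqP/[!addr_eq0]/eqP.
Qed.

Lemma elastica_grad_vel t : I t ->
  grad_vel (@elastic_lagrangian R) x t = (- 3 * dotv (a t) (a t)) *: v t.
Proof.
move=> It; case: elx => _ /(_ t It) v0 _.
rewrite /grad_vel elastic_gradient_vel// arcx//.
rewrite [dotv (derive1n 1 x t) _]elastica_velocity_acceleration//.
by rewrite !expr1n !divr1 expr0n !mulr0 scale0r subr0 sub0r mulNr.
Qed.

Lemma elastica_grad_acc t : I t ->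
  grad_acc (@elastic_lagrangian R) x t = 2 *: a t.
Proof.
move=> It.
rewrite /grad_acc elastic_gradient_acc// arcx//.
rewrite [dotv (derive1n 1 x t) _]elastica_velocity_acceleration//.
by rewrite !expr1n !divr1 !mulr0 scale0r subr0.
Qed.

(** The closed form of dL/da is an identity on the open set I, hence it may be
    differentiated. *)
Lemma elastica_grad_acc_derive t : I t ->
  derive1n 1 (grad_acc (@elastic_lagrangian R) x) t = 2 *: j t.
Proof.
move=> It; rewrite derive1n1 derive1E.
rewrite (@near_eq_derive _ _ _ _ (2 *: a)); last first.
  by apply: near_open openI It _; exact: elastica_grad_acc.
by have a' := @x' 2%N t isT It; rewrite derive_val.
Qed.

Lemma elastica_momentum t : I t ->
  momentum (@elastic_lagrangian R) x t =
  (- 3 * dotv (a t) (a t)) *: v t - 2 *: j t.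
Proof.
by move=> It; rewrite /momentum elastica_grad_vel// elastica_grad_acc_derive.
Qed.

Lemma elastica_momentum_conserved t : I t ->
  is_derive t 1 (momentum (@elastic_lagrangian R) x) 0.
Proof.
move=> It; have [v' _] := @x' 1%N t isT It.
have a' := @x' 2%N t isT It; have j' := @x' 3%N t isT It.
apply: momentum_derive; last by case: elx => _ _ /(_ t It).
- exact: gradient_cst.
- have k' : derivable (fun s => - 3 * dotv (a s) (a s)) t 1.
    by have [] := is_deriveZ (- 3) (is_derive_dotv a' a').
  apply: near_eq_derivable (derivable_scale k' v').
  by apply: near_open openI It _ => s /elastica_grad_vel/esym.
- apply: (@near_eq_derivable _ _ _ (2 *: j)).
    by apply: near_open openI It _ => s /elastica_grad_acc_derive/esym.
  by have [] := is_deriveZ 2 j'.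
Qed.

Lemma elastica_velocity_momentum t : I t ->
  dotv (v t) (momentum (@elastic_lagrangian R) x t) = - curvature x t ^+ 2.
Proof.
move=> It; have vv : dotv (v t) (v t) = 1 by rewrite -enorm_sqr arcx// expr1n.
rewrite elastica_momentum// /curvature enorm_sqr -/(a t).
(* The derivatives are opaque from here on: unification would otherwise unfold
   them when looking for scalings. *)
move: (v t) (a t) (j t) vv (elastica_velocity_jerk It) => vt at' jt vv vj.
rewrite dotvC dotvBl !dotvZl vv [dotv jt _]dotvC vj.
ring.
Qed.

End elastica.

Theorem theorem3p5 (R : realType) (I : set R) (x : R -> 'rV[R]_3)
    (openI : open I) (intervalI : is_interval I)
    (elx : elastica I x) (arcx : arclength_parametrized I x) :
  exists p : 'rV[R]_3,
    [/\ forall t : R, I t -> momentum (@elastic_lagrangian R) x t = p,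
        forall t : R, I t -> dotv (derive1n 1 x t) p = - curvature x t ^+ 2
      & forall t0 t : R, I t0 -> I t ->
          dotv (x t) p
          = dotv (x t0) p
            - oriented_integral t0 t (fun s : R => curvature x s ^+ 2)].
Proof.
have [[t1 It1]|I0] := pselect (exists t, I t); last first.
  by exists 0; split=> [t It|t It|t t' It]; case: I0; exists t.
exists (momentum (@elastic_lagrangian R) x t1).
have pE t : I t ->
    momentum (@elastic_lagrangian R) x t =
    momentum (@elastic_lagrangian R) x t1.
  move=> It; apply: (cst_on_interval intervalI) It It1.
  exact: elastica_momentum_conserved.
have vpE t : I t ->
    dotv (derive1n 1 x t) (momentum (@elastic_lagrangian R) x t1) =
    - curvature x t ^+ 2.
  by move=> It; rewrite -(pE t It); exact: elastica_velocity_momentum It.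
split=> // t0 t It0 It.
set p := momentum _ _ _; have [x' _ _] := elx.
have F' s : I s -> is_derive s 1 (fun s => - dotv (x s) p) (curvature x s ^+ 2).
  move=> Is; rewrite -[_ ^+ 2]opprK -vpE//.
  have xp' := is_derive_dotv (is_derive_derive1n (x' 0 s isT Is))
                             (is_derive_cst p s 1).
  by apply: is_derive_eq (is_deriveN xp') _; rewrite dotv0r addr0.
have f' s : I s -> derivable (fun s => curvature x s ^+ 2) s 1.
  move=> Is; have a' := is_derive_derive1n (x' 2 s isT Is).
  under eq_fun do rewrite enorm_sqr.
  by have [] := is_derive_dotv a' a'.
rewrite (oriented_integral_derivative intervalI F' f' It0 It).
ring.
Qed.
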